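(* Let $n\ge 1$, let $\mathcal{H}$ be a Hilbert space, and let $\mathcal{A}=[A_{ij}]_{i,j=1}^n$ be an $n\times n$ doubly normalised tensor (DNT) of positive semi-definite operators on $\mathcal{H}$, with row-measurements $\mathbf{R}^{(i)}=(A_{ij})_{j}$ and column-measurements $\mathbf{C}^{(j)}=(A_{ij})_{i}$. Then $\mathcal{A}$ admits a decomposition into permutation tensors, i.e. there is a quantum measurement $\mathbf{Q}=(Q_1,\dots,Q_{n!})$ on $\mathcal{H}$ with $\mathcal{A}=\sum_{l=1}^{n!}\Pi_l\otimes Q_l$, if and only if the set $\{\mathbf{R}^{(1)},\dots,\mathbf{R}^{(n)},\mathbf{C}^{(1)},\dots,\mathbf{C}^{(n)}\}$ of all its rows and columns is jointly measurable with a symmetric post-processing map, i.e. there are a mother measurement $\mathbf{M}=(M_k)_k$ and a post-processing map $\mu$ for this set such that $\mu(j|\mathbf{R}^{(i)},k)=\mu(i|\mathbf{C}^{(j)},k)$ for all $i,j,k$.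
   Context: $\mathcal{L}(\mathcal{H})$ is the space of (bounded) linear operators on $\mathcal{H}$, $I$ is the identity operator, and $A\ge 0$ means $A$ is positive semi-definite. A quantum measurement (POVM) with $m$ outcomes on $\mathcal{H}$ is a tuple $(A_1,\dots,A_m)\in\mathcal{L}(\mathcal{H})^m$ with $A_i\ge 0$ and $\sum_i A_i=I$. An $n\times n$ doubly normalised tensor (DNT) is an array $\mathcal{A}=[A_{ij}]\in\mathcal{L}(\mathcal{H})^{n\times n}$ with every $A_{ij}\ge 0$, $\sum_j A_{ij}=I$ for every $i$, and $\sum_i A_{ij}=I$ for every $j$. It is identified with $\sum_{i,j}E_{ij}\otimes A_{ij}$, where $E_{ij}$ is the $n\times n$ matrix unit with 1 in position $(i,j)$ and 0 elsewhere. $\Pi_1,\dots,\Pi_{n!}$ is an enumeration of the $n\times n$ permutation matrices; writing also $\Pi_l$ for the associated permutation of $\{1,\dots,n\}$, $\Pi_l=\sum_i E_{\Pi_l(i),i}$. A finite family of $n$-outcome measurements $\mathbf{A}^{(1)},\dots,\mathbf{A}^{(m)}$ is jointly measurable if there are a measurement $\mathbf{M}=(M_k)_k$ with finitely many outcomes (a mother measurement) and real numbers $\mu(j|\mathbf{A}^{(i)},k)\ge 0$ (a post-processing map) with $\sum_j\mu(j|\mathbf{A}^{(i)},k)=1$ for all $i,k$, such that $A^{(i)}_j=\sum_k\mu(j|\mathbf{A}^{(i)},k)M_k$ for all $i,j$. The dependence of $\mu$ on $\mathbf{A}^{(i)}$ is through its label in the family. For the rows and columns of a DNT, this means $A_{ij}=\sum_k\mu(j|\mathbf{R}^{(i)},k)M_k=\sum_k\mu(i|\mathbf{C}^{(j)},k)M_k$,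 with $\sum_j\mu(j|\mathbf{R}^{(i)},k)=1$ for all $i,k$ and $\sum_i\mu(i|\mathbf{C}^{(j)},k)=1$ for all $j,k$. *)

(* Defs.v *)
From HB Require Import structures.
From mathcomp Require Import all_boot all_order all_algebra all_fingroup.
From mathcomp Require Import sesquilinear.
From mathcomp.real_closed Require Import complex.
From mathcomp Require Import boolp classical_sets functions reals topology normedtype.

Set Implicit Arguments.
Unset Strict Implicit.
Unset Printing Implicit Defensive.

Import Order.TTheory GRing.Theory Num.Theory.
Import numFieldNormedType.Exports.

Local Open Scope ring_scope.
Local Open Scope complex_scope.

(* Complex Hilbert space of arbitrary dimension: a Banach space over R[i]
   whose norm comes from an inner product.  The form is linear in its first
   argument and conjugate-linear in its second. *)
HB.mixin Record isHilbert (R : realType) (H : Type)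
    of CompleteNormedModule R[i] H := {
  inner : {dot H for (@Num.conj R[i])} ;
  inner_normE : forall x : H, inner x x = `|x| ^+ 2
}.

#[short(type="hilbertType")]
HB.structure Definition Hilbert (R : realType) :=
  {H of isHilbert R H & CompleteNormedModule R[i] H}.

Section BoundedOperators.
Context {R : realType} (H : hilbertType R).

Definition bounded_linear (f : H -> H) : Prop :=
  linear f /\ exists c : R, forall x, `|f x| <= c%:C * `|x|.

Definition bounded_linear_pred : {pred H -> H} :=
  [pred f | `[< bounded_linear f >]].

Lemma bounded_linear_submod_closed : submod_closed bounded_linear_pred.
Proof.
split=> [|a f g /asboolP[lf [c fc]] /asboolP[lg [d gd]]]; apply/asboolP; split.
- by move=> k u v; rewrite /= /GRing.zero /= scaler0 addr0.
- by exists 0 => x; rewrite /GRing.zero /= normr0 mul0r.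
- move=> k u v.
  have E x : (a *: f + g) x = a *: f x + g x by [].
  by rewrite !E lf lg !scalerDr !scalerA (mulrC a k) addrACA.
- exists (complex.Re `|a| * c + d) => x.
  have E : (a *: f + g) x = a *: f x + g x by [].
  have na : (complex.Re `|a|)%:C = `|a| by rewrite RRe_real// normr_real.
  rewrite E rmorphD rmorphM/= na mulrDl (le_trans (ler_normD _ _))//.
  by rewrite lerD// normrZ -mulrA ler_wpM2l.
Qed.

HB.instance Definition _ := GRing.isSubmodClosed.Build R[i] (H -> H)
  bounded_linear_pred bounded_linear_submod_closed.

(* The space L(H) of bounded linear operators. *)
Record lop := LOp {
  lop_fun :> H -> H ;
  lop_funP : lop_fun \in bounded_linear_pred }.

HB.instance Definition _ := [isSub for lop_fun].
HB.instance Definition _ := [Choice of lop by <:].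
HB.instance Definition _ := [SubChoice_isSubLmodule of lop by <:].

Lemma bounded_linear_id : idfun \in bounded_linear_pred.
Proof.
by apply/asboolP; split=> [//|]; exists 1 => x; rewrite rmorph1 mul1r.
Qed.

Definition idop : lop := LOp bounded_linear_id.

End BoundedOperators.

Arguments idop {R H}.

Section Measurements.
Context {R : realType} {H : hilbertType R}.

(* The order of R[i] makes this say that <A x, x> is real and nonnegative. *)
Definition psd (A : lop H) : Prop := forall x : H, 0 <= inner (A x) x.

Definition povm m (M : 'I_m -> lop H) : Prop :=
  (forall k, psd (M k)) /\ \sum_k M k = idop.

Definition dnt n (A : 'M[lop H]_n) : Prop :=
  [/\ forall i j, psd (A i j),
      forall i, \sum_j A i j = idop &
      forall j, \sum_i A i j = idop].

(* E (x) Q as an array, under the identification [A_ij] = sum E_ij (x) A_ij. *)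
Definition tensmx n (E : 'M[R[i]]_n) (Q : lop H) : 'M[lop H]_n :=
  \matrix_(i, j) (E i j *: Q).

(* This is the transpose of MathComp's perm_mx s. *)
Definition permutation_mx n (s : 'S_n) : 'M[R[i]]_n :=
  \sum_i delta_mx (s i) i.

Definition permutation_decomposable n (Pi : 'I_(n`!) -> 'S_n)
    (A : 'M[lop H]_n) : Prop :=
  exists2 Q : 'I_(n`!) -> lop H,
    povm Q & A = \sum_l tensmx (permutation_mx (Pi l)) (Q l).

(* mu j x k is mu(j | A^(x), k), with x the label of a measurement. *)
Definition post_processing (I : Type) n m (mu : 'I_n -> I -> 'I_m -> R) : Prop :=
  (forall j x k, 0 <= mu j x k) /\ (forall x k, \sum_j mu j x k = 1).

Definition jointly_measurable_by (I : Type) n m (F : I -> 'I_n -> lop H)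
    (M : 'I_m -> lop H) (mu : 'I_n -> I -> 'I_m -> R) : Prop :=
  [/\ povm M, post_processing mu &
      forall x j, F x j = \sum_k (mu j x k)%:C *: M k].

(* The label inl i stands for the row R^(i), inr j for the column C^(j). *)
Definition rows_and_columns n (A : 'M[lop H]_n) (x : 'I_n + 'I_n) :
    'I_n -> lop H :=
  match x with
  | inl i => fun j => A i j
  | inr j => fun i => A i j
  end.

Definition symmetric_post_processing n m
    (mu : 'I_n -> 'I_n + 'I_n -> 'I_m -> R) : Prop :=
  forall i j k, mu j (inl i) k = mu i (inr j) k.

Definition symmetrically_jointly_measurable n (A : 'M[lop H]_n) : Prop :=
  exists (m : nat) (M : 'I_m -> lop H) (mu : 'I_n -> 'I_n + 'I_n -> 'I_m -> R),
    jointly_measurable_by (rows_and_columns A) M mu /\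
    symmetric_post_processing mu.

End Measurements.

(* Main.v *)
Require Import Defs.
From mathcomp Require Import all_boot all_algebra all_fingroup reals.
From mathcomp Require Import all_order sesquilinear.
From mathcomp.real_closed Require Import complex.

(** For each outcome [k], symmetry of the post-processing says exactly that
    the matrix [mu(j | R^(i), k)] has both row and column sums equal to [1].
    By the Birkhoff-von Neumann theorem it is a convex combination of
    permutation matrices with weights [c k s], and [Q_s = \sum_k c k s M_k]
    decomposes the tensor.  Conversely, [Q] is itself a mother measurement,
    with the permutation matrices as deterministic post-processing. *)

Set Implicit Arguments.
Unset Strict Implicit.
Unset Printing Implicit Defensive.

Import Order.TTheory GRing.Theory Num.Theory.

(** * Hall's marriage theorem for finite families of finite sets *)

Section Hall.
Variables I T : finType.
Implicit Types (A : I -> {set T}) (J K : {set I}).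

Definition hall_condition A :=
  [forall J : {set I}, #|J| <= #|\bigcup_(i in J) A i|].

Definition remove_elt A i x : I -> {set T} :=
  fun k => if k == i then A i :\ x else A k.

(** A set violating the condition after the removal must contain [i], since the other sets are
    unchanged; deleting [i] from it turns the strict inequality into a weak one. *)
Lemma hall_violation A i x :
  hall_condition A -> ~~ hall_condition (remove_elt A i x) ->
  exists2 J : {set I}, i \notin J & #|(A i :\ x) :|: \bigcup_(k in J) A k| <= #|J|.
Proof.
move=> /forallP hA; rewrite negb_forall => /existsP[J]; rewrite -ltnNge => hJ.
have remE (K : {set I}) : i \notin K ->
    \bigcup_(k in K) remove_elt A i x k = \bigcup_(k in K) A k.
  move=> iK; apply: eq_bigr => k kK; rewrite /remove_elt.
  by case: eqP => // ki; rewrite -ki kK in iK.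
have iJ : i \in J.
  by apply/negPn/negP => iJ; move: hJ; rewrite remE // ltnNge hA.
exists (J :\ i); first by rewrite setD11.
rewrite -ltnS -[X in _ < X]/((1 + #|J :\ i|)%N).
have <- : #|J| = (1 + #|J :\ i|)%N by rewrite (cardsD1 i J) iJ.
move: hJ; rewrite (big_setD1 i) //= remE ?setD11 //.
by rewrite {1}/remove_elt eqxx.
Qed.

(* Rado's argument: of two elements of [A i], one can always be removed
   without violating Hall's condition, by submodularity of
   [J |-> #|\bigcup_(i in J) A i|]. *)
Lemma hall_remove A i x y : hall_condition A -> x != y ->
  hall_condition (remove_elt A i x) || hall_condition (remove_elt A i y).
Proof.
move=> hA xy; apply/negPn/negP; rewrite negb_or => /andP[hx hy].
have [J iJ leJ] := hall_violation hA hx.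
have [K iK leK] := hall_violation hA hy.
move: hA => /forallP hA.
set X := _ :|: _ in leJ; set Y := _ :|: _ in leK.
(* Since [x != y], all of [A i] lies in [X :|: Y], so Hall's condition can be used for [J :|: K]
   enlarged by [i]. *)
have le1 : #|i |: (J :|: K)| <= #|X :|: Y|.
  apply: leq_trans (hA _) (subset_leq_card _).
  apply/bigcupsP => k; rewrite !inE => /orP[/eqP->|/orP[kJ|kK]];
    apply/subsetP => z zA; rewrite !inE.
  - rewrite zA !andbT; case: (eqVneq z x) => [->|] //=.
    by rewrite xy orbT.
  - by apply/orP; left; apply/orP; right; apply/bigcupP; exists k.
  - by apply/orP; right; apply/orP; right; apply/bigcupP; exists k.
have le2 : #|J :&: K| <= #|X :&: Y|.
  apply: leq_trans (hA _) (subset_leq_card _).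
  apply/bigcupsP => k; rewrite inE => /andP[kJ kK].
  apply/subsetP => z zA; rewrite !inE.
  by apply/andP; split; apply/orP; right; apply/bigcupP; exists k.
(* The sum reads [1 + #|J| + #|K| <= #|X| + #|Y|], against [leJ] and [leK]. *)
have := leq_add le1 le2; rewrite cardsUI cardsU1 inE negb_or iJ iK /=.
rewrite -addnA cardsUI add1n ltnNge.
by rewrite (leq_add leJ leK).
Qed.

(** Induction on the total size: while some [A i] has two elements, [hall_remove] allows dropping
    one. Once none does, Hall's condition forces the sets to be pairwise distinct singletons. *)
Theorem hall_marriage A : hall_condition A ->
  exists2 f : I -> T, injective f & forall i, f i \in A i.
Proof.
have [n] := ubnP (\sum_i #|A i|); elim: n A => // n IHn A ltAn hA.
have [/existsP[i /card_gt1P[x [y [xA yA xy]]]]|noA] :=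
    boolP [exists i, 1 < #|A i|].
  have dec z : z \in A i -> hall_condition (remove_elt A i z) ->
      exists2 f : I -> T, injective f & forall i, f i \in A i.
    move=> zA hz; case: (IHn _ _ hz) => [|f finj fA].
      apply: leq_trans _ (ltAn : _ <= n); rewrite (bigD1 i) //= [X in _ < X](bigD1 i) //=.
      rewrite /remove_elt eqxx (cardsD1 z (A i)) zA add1n addSn ltnS.
      rewrite leq_add2l; apply/eq_leq/eq_bigr => k.
      by case: eqP.
    exists f => // k; have := fA k; rewrite /remove_elt.
    by case: eqP => // ->; rewrite inE => /andP[].
  by case/orP: (hall_remove i hA xy) => /dec; apply.
have cardA i : #|A i| == 1.
  rewrite eqn_leq leqNgt; apply/andP; split.
    by apply: contra noA => ?; apply/existsP; exists i.
  by have /forallP/(_ [set i]) := hA; rewrite cards1 big_set1.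
have [f fA] : exists f : I -> T, forall i, A i = [set f i].
  by apply: (fin_all_exists (P := fun i x => A i = [set x])) => i; apply/cards1P.
exists f => [i j fij|i]; last by rewrite fA set11.
apply/eqP/negPn/negP => ij.
have /forallP/(_ [set i; j]) := hA.
by rewrite cards2 ij bigcup_setU !big_set1 !fA fij setUid cards1.
Qed.

End Hall.

Local Open Scope ring_scope.

(** * The Birkhoff-von Neumann theorem *)

Section Birkhoff.
Variables (R : realFieldType) (n : nat).
Implicit Types (D : 'I_n -> 'I_n -> R) (r : R).

(* [r] is kept arbitrary since subtracting multiples of permutation matrices
   lowers it. *)
Definition doubly_regular r D :=
  [/\ forall i j, 0 <= D i j, forall i, \sum_j D i j = r
    & forall j, \sum_i D i j = r].

(** Hall's condition for the supports of the columns follows by double counting: the columns in [J]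
    have total mass [#|J| * r], all of it in the rows that meet their supports, and each of these
    rows has mass only [r]. *)
Lemma positive_transversal r D : 0 < r -> doubly_regular r D ->
  exists s : 'S_n, forall j, 0 < D (s j) j.
Proof.
move=> r0 [D0 Dr Dc].
pose A j := [set i | 0 < D i j].
suff hA : hall_condition A.
  have [f finj fA] := hall_marriage hA.
  by exists (perm finj) => j; have := fA j; rewrite permE inE.
apply/forallP => J; rewrite -(ler_nat R) -(ler_pM2r r0).
rewrite !mulr_natl -!sumr_const.
rewrite -(eq_bigr _ (fun j _ => Dc j)) -(eq_bigr _ (fun i _ => Dr i)).
apply: (@le_trans _ _ (\sum_(j in J) \sum_(i in \bigcup_(k in J) A k) D i j)).
  apply: ler_sum => j jJ.
  rewrite (bigID (mem (\bigcup_(k in J) A k))) /= gerDl.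
  rewrite big1 // => i iNA; apply/le_anti; rewrite D0 andbT leNgt.
  apply: contra iNA => Dij; apply/bigcupP; exists j => //.
  by rewrite inE.
rewrite exchange_big /=; apply: ler_sum => i _.
by rewrite [leRHS](bigID (mem J)) /= lerDl sumr_ge0.
Qed.

(** Induction on the number of positive entries: subtracting [t] times the permutation matrix of a
    positive transversal, with [t] its least entry, keeps the entries nonnegative and makes at least
    one more vanish. *)
Theorem birkhoff r D : 0 <= r -> doubly_regular r D ->
  exists2 c : 'S_n -> R, forall s, 0 <= c s
    & forall i j, D i j = \sum_(s : 'S_n) (s j == i)%:R * c s.
Proof.
have [m] := ubnP #|[set p : 'I_n * 'I_n | 0 < D p.1 p.2]|.
elim: m r D => // m IHm r D ltm r0 DD.
have [D0 Dr Dc] := DD.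
have zero_case : (forall i j, D i j = 0) ->
    exists2 c : 'S_n -> R, forall s, 0 <= c s
      & forall i j, D i j = \sum_(s : 'S_n) (s j == i)%:R * c s.
  move=> Dz; exists (fun=> 0) => // i j.
  by rewrite Dz big1 // => s _; rewrite mulr0.
have [r_eq0|r_neq0] := eqVneq r 0.
  apply: zero_case => i j; have /eqP := Dr i.
  by rewrite r_eq0 psumr_eq0 // => /allP/(_ j (mem_index_enum _))/eqP.
(* The index [j0] starts the search for the minimum and later exhibits [r - t] as a row sum. *)
have [/card0_eq noI|/card_gt0P[j0 _]] := posnP #|'I_n|.
  by apply: zero_case => i; have := noI i; rewrite inE.
have rgt0 : 0 < r by rewrite lt_def r_neq0.
have [s sD] := positive_transversal rgt0 DD.
pose jm := [arg min_(j < j0) D (s j) j]%O.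
have [jmin tmin] : exists jmin, forall j, D (s jmin) jmin <= D (s j) j.
  exists jm; rewrite /jm; case: Order.TotalTheory.arg_minP => //= j _ le_j k.
  exact: le_j.
pose t := D (s jmin) jmin.
pose D' i j := D i j - (s j == i)%:R * t.
have sumr i : \sum_j (s j == i)%:R * t = t.
  rewrite (bigD1 ((s^-1)%g i)) //= permKV eqxx mul1r big1 ?addr0 // => j.
  by case: (eqVneq (s j) i) => [<-|]; rewrite ?permK ?eqxx ?mul0r.
have sumc j : \sum_i (s j == i)%:R * t = t.
  rewrite (bigD1 (s j)) //= eqxx mul1r big1 ?addr0 // => i.
  by rewrite eq_sym => /negPf->; rewrite mul0r.
have D'0 i j : 0 <= D' i j.
  rewrite /D'; case: eqP => [<-|_]; first by rewrite mul1r subr_ge0 tmin.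
  by rewrite mul0r subr0.
have DD' : doubly_regular (r - t) D'.
  by split=> // [i|j]; rewrite big_split /= sumrN ?sumr ?sumc ?Dr ?Dc.
have rt0 : 0 <= r - t by case: DD' => _ /(_ j0) <- _; apply: sumr_ge0.
case: (IHm _ _ _ rt0 DD') => [|c c0 cE].
  apply: leq_trans _ (ltm : (_ <= m)%N); apply: proper_card.
  apply/properP; split.
    apply/subsetP => -[i j]; rewrite !inE /= => /lt_le_trans; apply.
    by rewrite gerBl mulr_ge0 // ltW // sD.
  exists (s jmin, jmin); rewrite !inE /= ?sD //.
  by rewrite /D' eqxx mul1r subrr ltxx.
exists (fun u => c u + (u == s)%:R * t) => [u|i j].
  by rewrite addr_ge0 // mulr_ge0 // ltW // sD.
under eq_bigr => u _ do rewrite mulrDr.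
rewrite big_split /= -cE /D' [X in _ + X](bigD1 s) //= eqxx mul1r.
rewrite [X in _ + (_ + X)]big1 ?addr0 ?subrK // => u /negPf->.
by rewrite mul0r mulr0.
Qed.

End Birkhoff.

Local Open Scope complex_scope.

(** * Positive operators and entries of permutation tensors *)

Section Operators.
Variables (R : realType) (H : hilbertType R).

Lemma psd_sum_scale (I : finType) (a : I -> R) (M : I -> lop H) :
  (forall k, 0 <= a k) -> (forall k, psd (M k)) ->
  psd (\sum_k (a k)%:C *: M k).
Proof.
move=> a0 M0; apply: (big_ind (fun B : lop H => psd B)).
- by move=> x; rewrite [X in inner X _](_ : _ = 0) // linear0l.
- move=> B C B0 C0 x.
  rewrite [X in inner X _](_ : _ = B x + C x) // linearDl.
  exact: addr_ge0 (B0 x) (C0 x).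
- move=> k _ x.
  rewrite [X in inner X _](_ : _ = (a k)%:C *: M k x) // linearZl_LR.
  by apply: mulr_ge0 (M0 k x); rewrite lecR.
Qed.

Lemma permutation_mxE n (s : 'S_n) i j :
  permutation_mx s i j = ((s j == i)%:R : R)%:C.
Proof.
rewrite /permutation_mx summxE (bigD1 j) //= mxE eqxx andbT big1 ?addr0.
  by rewrite eq_sym rmorph_nat.
by move=> k kj; rewrite mxE eq_sym [j == k]eq_sym (negPf kj) andbF.
Qed.

Lemma permutation_tensor_sumE n m (Pi : 'I_m -> 'S_n) (Q : 'I_m -> lop H) i j :
  (\sum_l tensmx (permutation_mx (Pi l)) (Q l)) i j =
  \sum_l ((Pi l j == i)%:R : R)%:C *: Q l.
Proof.
by rewrite summxE; apply: eq_bigr => l _; rewrite mxE permutation_mxE.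
Qed.

Lemma sum_perm_row n (s : 'S_n) i : \sum_j (s j == i)%:R = 1 :> R.
Proof.
rewrite (bigD1 ((s^-1)%g i)) //= permKV eqxx big1 ?addr0 // => j.
by case: (eqVneq (s j) i) => [<-|]; rewrite ?permK ?eqxx.
Qed.

Lemma sum_perm_col n (s : 'S_n) j : \sum_i (s j == i)%:R = 1 :> R.
Proof.
by rewrite (bigD1 (s j)) //= eqxx big1 ?addr0 // => i; rewrite eq_sym => /negPf->.
Qed.

End Operators.

Theorem theorem4 (R : realType) (H : hilbertType R) (n : nat) (hn : (1 <= n)%N)
    (Pi : 'I_(n`!) -> 'S_n) (hPi : bijective Pi)
    (A : 'M[lop H]_n) (hA : dnt A) :
  permutation_decomposable Pi A <-> symmetrically_jointly_measurable A.
Proof.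
split=> [[Q povmQ AE]|[m [M [mu [[[M0 M1] [mu0 mu1] muE] mu_sym]]]]].
  (* At a row label and at a column label, the map reads the same entry of the matrix of [Pi l], so
     its symmetry holds by computation. *)
  exists n`!, Q, (fun j x l => match x with
    | inl i => (Pi l j == i)%:R
    | inr j' => (Pi l j' == j)%:R end).
  split=> //; split=> //.
  - split=> [j [i|i] k|[i|j] k]; rewrite ?ler0n //.
      exact: sum_perm_row.
    exact: sum_perm_col.
  - by move=> [i|i] j /=; rewrite AE permutation_tensor_sumE.
have regular k : doubly_regular 1 (fun i j => mu j (inl i) k).
  split=> [i j|i|j]; [exact: mu0|exact: mu1|].
  (* Symmetry turns a column sum into the normalisation of [mu] at the label [inr j]. *)
  by under eq_bigr => i _ do rewrite mu_sym; exact: mu1.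
have [c cP] : exists c : 'I_m -> 'S_n -> R, forall k,
    (forall s, 0 <= c k s) /\
    forall i j, mu j (inl i) k = \sum_(s : 'S_n) (s j == i)%:R * c k s.
  apply: (fin_all_exists (P := fun k (c : 'S_n -> R) => (forall s, 0 <= c s) /\
    forall i j, mu j (inl i) k = \sum_(s : 'S_n) (s j == i)%:R * c s)) => k.
  by have [c c0 cE] := birkhoff ler01 (regular k); exists c.
(* Obtained by summing the expansion over one row, which exists because [n] is positive: each
   permutation matrix contributes exactly one entry. *)
have c_sum k : \sum_s c k s = 1.
  rewrite -(mu1 (inl (Ordinal hn)) k).
  under [RHS]eq_bigr => j _ do rewrite (cP k).2.
  rewrite exchange_big; apply: eq_bigr => s _ /=.
  by rewrite -mulr_suml sum_perm_row mul1r.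
have reindexPi (V : nmodType) (F : 'S_n -> V) : \sum_l F (Pi l) = \sum_s F s.
  by rewrite [RHS](reindex Pi) //; apply: onW_bij.
exists (fun l => \sum_k (c k (Pi l))%:C *: M k).
  split=> [l|]; first by apply: psd_sum_scale => // k; apply: (cP k).1.
  rewrite exchange_big -M1; apply: eq_bigr => k _ /=.
  by rewrite -scaler_suml -rmorph_sum reindexPi c_sum rmorph1 scale1r.
apply/matrixP => i j; rewrite permutation_tensor_sumE.
rewrite [LHS](muE (inl i) j).
under [RHS]eq_bigr => l _ do rewrite scaler_sumr.
rewrite exchange_big; apply: eq_bigr => k _ /=.
under [RHS]eq_bigr => l _ do rewrite scalerA -rmorphM.
rewrite -scaler_suml -rmorph_sum /= (reindexPi _ (fun s => (s j == i)%:R * c k s)).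
by rewrite (cP k).2.
Qed.
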